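(* There is a polynomial-time $O(\sqrt{n\log n})$-approximation algorithm for the 1-DR-2 problem, where $n$ is the number of vertices of the input graph.
   Context: For a graph $G=(V,E)$ and $S\subseteq V$, $G[S]$ is the subgraph induced by $S$. For vertices $u,v$, $m_G(u,v)$ is the number of internal vertices on a shortest $u$–$v$ path in $G$ (so $m_G(u,v)=0$ if $u,v$ are adjacent, and $m_G(u,v)=1$ if they are non-adjacent but have a common neighbor); it is $\infty$ if no path exists. For $D\subseteq V$, $m^D_G(u,v)=m_{G[D\cup\{u,v\}]}(u,v)$. Two vertices $u,v$ form a target couple $[u,v]$ if $m_G(u,v)=1$. A set $D$ covers a target couple $[u,v]$ if $m^D_G(u,v)\le 2$. A set $D$ is a dominating set if every vertex of $V\setminus D$ is adjacent to a vertex of $D$. The 1-DR-2 problem: given a connected graph $G$, find a minimum-cardinality dominating set $D$ of $G$ that covers every target couple of $G$. An $r$-approximation algorithm outputs a feasible solution of size at most $r$ times the optimum. *)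

(* Defs.v *)
From HB Require Import structures.
From mathcomp Require Import all_boot all_order all_algebra.
From mathcomp Require Import all_classical all_reals all_analysis.

Set Implicit Arguments.
Unset Strict Implicit.
Unset Printing Implicit Defensive.

Import Order.TTheory GRing.Theory Num.Theory.
Import numFieldNormedType.Exports.

Local Open Scope nat_scope.

(** * Graphs and the 1-DR-2 problem *)

Section Graphs.
Variable V : finType.
Implicit Types (e : rel V) (D S : {set V}) (u v : V).

Definition simple_graph e : Prop := symmetric e /\ irreflexive e.

Definition connected_graph e : Prop :=
  0 < #|V| /\ forall u v, connect e u v.

(* The subgraph induced by S is kept on the type V: the vertices outside S
   become isolated, so that paths between vertices of S are the paths of G[S]. *)
Definition induced e S : rel V :=
  [rel x y | [&& x \in S, y \in S & e x y]].

(* The simple paths from u to v with k edges, as vertex sequences u :: p. *)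
Definition has_path e u v (k : nat) : bool :=
  [exists p : k.-tuple V, [&& path e u p, last u p == v & uniq (u :: p)]].

(* A simple path has fewer than #|V| edges; a shortest one with k edges has
   k.-1 internal vertices.  None stands for infinity. *)
Definition m_G e u v : option nat :=
  omap predn (ohead [seq k <- iota 0 #|V| | has_path e u v k]).

Definition le_fin (x : option nat) (b : nat) : bool :=
  if x is Some k then k <= b else false.

Definition m_G_in e D u v : option nat :=
  m_G (induced e (D :|: [set u; v])) u v.

Definition target_couple e u v : bool := m_G e u v == Some 1.

Definition covers e D u v : bool := le_fin (m_G_in e D u v) 2.

Definition dominating e D : bool :=
  [forall v, (v \notin D) ==> [exists u in D, e v u]].

Definition feasible e D : bool :=
  dominating e D &&
  [forall u, forall v, target_couple e u v ==> covers e D u v].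

(* [set: V] is feasible, see feasible_setT. *)
Definition opt e : nat := #|[arg min_(D < [set: V] | feasible e D) #|D|]|.

Lemma feasible_setT e : feasible e [set: V].
Proof.
apply/andP; split; first by apply/forallP=> v; rewrite inE.
apply/forallP=> u; apply/forallP=> v; apply/implyP=> /eqP huv.
rewrite /covers /m_G_in; suff -> : induced e ([set: V] :|: [set u; v]) = e.
  by rewrite huv.
by apply/funext=> x; apply/funext=> y; rewrite /induced /= !inE.
Qed.

End Graphs.

(** * Random access machines *)

(* Structured programs over arrays of natural numbers.  Every operation costs
   one unit.  There is no multiplication: addition and truncated subtraction
   lengthen the binary size of the numbers by O(1) per unit of time, so that
   polynomial time here is polynomial time on a Turing machine. *)

Inductive expr : Type :=
| Cst of nat
| Rd of nat & expr          (* array name, index *)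
| Add of expr & expr
| Sub of expr & expr.

Inductive cmd : Type :=
| Skip
| Wr of nat & expr & expr   (* array name, index, new value *)
| Seq of cmd & cmd
| If of expr & cmd & cmd
| While of expr & cmd.

Definition store : Type := nat -> nat -> nat.

Fixpoint eval (s : store) (x : expr) : nat :=
  match x with
  | Cst k => k
  | Rd a i => s a (eval s i)
  | Add x1 x2 => eval s x1 + eval s x2
  | Sub x1 x2 => eval s x1 - eval s x2
  end.

Fixpoint cost (x : expr) : nat :=
  match x with
  | Cst _ => 1
  | Rd _ i => (cost i).+1
  | Add x1 x2 | Sub x1 x2 => (cost x1 + cost x2).+1
  end.

Definition upd (s : store) (a i k : nat) : store :=
  fun b j => if (b == a) && (j == i) then k else s b j.

(* exec c s t s' : started in s, the program c halts in s' after time t. *)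
Inductive exec : cmd -> store -> nat -> store -> Prop :=
| ExecSkip s : exec Skip s 1 s
| ExecWr s a i x :
    exec (Wr a i x) s (cost i + cost x).+1 (upd s a (eval s i) (eval s x))
| ExecSeq c1 c2 s t1 s1 t2 s2 :
    exec c1 s t1 s1 -> exec c2 s1 t2 s2 -> exec (Seq c1 c2) s (t1 + t2) s2
| ExecIfT x c1 c2 s t s1 : eval s x != 0 ->
    exec c1 s t s1 -> exec (If x c1 c2) s (cost x + t).+1 s1
| ExecIfF x c1 c2 s t s1 : eval s x = 0 ->
    exec c2 s t s1 -> exec (If x c1 c2) s (cost x + t).+1 s1
| ExecWhileT x c s t1 s1 t2 s2 : eval s x != 0 ->
    exec c s t1 s1 -> exec (While x c) s1 t2 s2 ->
    exec (While x c) s (cost x + t1 + t2).+1 s2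
| ExecWhileF x c s : eval s x = 0 -> exec (While x c) s (cost x).+1 s.

Lemma exec_det c s t1 s1 t2 s2 :
  exec c s t1 s1 -> exec c s t2 s2 -> t1 = t2 /\ s1 = s2.
Proof.
move=> h; elim: h t2 s2 => {c s t1 s1}; intros;
  match goal with H : exec _ _ _ ?s |- _ = _ /\ _ = ?s => inversion H; subst end;
  repeat match goal with
  | IH : forall t s, exec ?c ?s0 t s -> _, H : exec ?c ?s0 _ _ |- _ =>
      case: (IH _ _ H) => ? ?; subst; clear H
  | H : eval ?s ?x = 0, H' : is_true (eval ?s ?x != 0) |- _ =>
      by rewrite H in H'
  end; by split.
Qed.

(* The input graph on {0, ..., n-1}: n in cell 0 of array 0, the adjacency
   matrix in row-major order in array 1, and 0 in every other cell. *)
Definition graph_input (n : nat) (e : rel 'I_n) : store :=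
  fun a i =>
    match a with
    | 0 => if i == 0 then n else 0
    | 1 => [exists u : 'I_n, exists v : 'I_n, (i == u * n + v) && e u v] : nat
    | _ => 0
    end.

(* The output set is given by its characteristic vector in array 2. *)
Definition set_output (n : nat) (s : store) : {set 'I_n} :=
  [set v : 'I_n | s 2 v != 0].

(* On input e, the program alg halts after time t with output D. *)
Definition outputs (alg : cmd) (n : nat) (e : rel 'I_n) (t : nat)
    (D : {set 'I_n}) : Prop :=
  exists2 s, exec alg (graph_input e) t s & D = set_output n s.

(* The input has size Theta(n^2), hence polynomial in n and polynomial in the
   input size are the same. *)
Definition polynomial_time (alg : cmd) : Prop :=
  exists c k : nat, forall (n : nat) (e : rel 'I_n),
    simple_graph e -> connected_graph e ->
    exists t D, outputs alg e t D /\ t <= c * n ^ k + c.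

Definition approximation_algorithm (R : realType) (r : nat -> R) (alg : cmd) : Prop :=
  forall (n : nat) (e : rel 'I_n),
    simple_graph e -> connected_graph e ->
    exists t D, [/\ outputs alg e t D, feasible e D
                  & (#|D|%:R <= r n * (opt e)%:R)%R].

(* Main.v *)
(** A set of vertices is built greedily, two vertices at a time: every feasible
    set Dopt serves each requirement (dominating a vertex, covering a target
    couple) through a pair of its own vertices, so some pair serves a fraction
    1 / #|Dopt|^2 of the requirements that are still open, and the pair serving
    most of them does at least as well.  As there are at most n^3 requirements,
    the greedy set has at most 6 k^2 ln n + 3 vertices, where k is the optimum;
    it also has at most n vertices, and the smaller of the two bounds is at most
    (6 sqrt (n ln n) + 3) k. *)

Require Import Defs.
From mathcomp Require Import all_boot all_order all_algebra.
From mathcomp Require Import all_classical all_reals all_analysis.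
From mathcomp Require Import zify lra.
Import Defs.

Set Implicit Arguments.
Unset Strict Implicit.
Unset Printing Implicit Defensive.

Import Order.TTheory GRing.Theory Num.Theory.
Import numFieldNormedType.Exports.

Local Open Scope nat_scope.

(** * Programs with bounded loops *)

(** The only loop is a [for] over 0, ..., n-1 with n read from cell 0 of array 0, so termination and
    a polynomial running time follow by induction on the syntax. *)
Inductive prog : Type :=
| PWr of nat & expr & expr
| PSeq of prog & prog
| PIf of expr & prog
| PFor of nat & prog.

Definition scalar (a : nat) : expr := Rd a (Cst 0).

Definition PSet (a : nat) (x : expr) : prog := PWr a (Cst 0) x.

(** The loop counter lives in cell 0 of array [v]. Truncated subtraction makes the guard n - v
    nonzero exactly while v < n. *)
Fixpoint compile (p : prog) : cmd :=
  match p with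
  | PWr a i x => Wr a i x
  | PSeq p q => Seq (compile p) (compile q)
  | PIf x p => If x (compile p) Skip
  | PFor v p =>
      Seq (Wr v (Cst 0) (Cst 0))
          (While (Sub (scalar 0) (scalar v))
             (Seq (compile p) (Wr v (Cst 0) (Add (scalar v) (Cst 1)))))
  end.

Definition incr (v : nat) (s : store) : store := upd s v 0 (s v 0 + 1).

Fixpoint denote (p : prog) (s : store) : store :=
  match p with
  | PWr a i x => upd s a (eval s i) (eval s x)
  | PSeq p q => denote q (denote p s)
  | PIf x p => if eval s x != 0 then denote p s else s
  | PFor v p => iter (s 0 0) (incr v \o denote p) (upd s v 0 0)
  end.

Fixpoint mods (p : prog) : seq nat :=
  match p with
  | PWr a _ _ => [:: a]
  | PSeq p q => mods p ++ mods q
  | PIf _ p => mods p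
  | PFor v p => v :: mods p
  end.

(** No write reaches array 0, which holds the loop bound, and no loop body writes to its own
    counter; hence each loop runs exactly n times. *)
Fixpoint wf (p : prog) : bool :=
  match p with
  | PWr a _ _ => a != 0
  | PSeq p q => wf p && wf q
  | PIf _ p => wf p
  | PFor v p => [&& v != 0, v \notin mods p & wf p]
  end.

Definition agree (l : seq nat) (s s' : store) : Prop :=
  forall a, a \notin l -> s' a = s a.

Lemma upd_other s a i k b : b != a -> upd s a i k b = s b.
Proof. by rewrite /upd => /negbTE ->. Qed.

Lemma upd_same s a i k : upd s a i k a i = k.
Proof. by rewrite /upd !eqxx. Qed.

Lemma agree_trans l s1 s2 s3 : agree l s1 s2 -> agree l s2 s3 -> agree l s1 s3.
Proof. by move=> h1 h2 a ha; rewrite (h2 a ha) (h1 a ha). Qed.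

Lemma agree_sub l1 l2 s1 s2 :
  agree l1 s1 s2 -> {subset l1 <= l2} -> agree l2 s1 s2.
Proof. by move=> h2 h1 a ha; apply: h2; apply: contra ha; apply: h1. Qed.

Lemma agree_upd s a i k : agree [:: a] s (upd s a i k).
Proof. by move=> b; rewrite inE; apply: upd_other. Qed.

Lemma denote_agree p s : agree (mods p) s (denote p s).
Proof.
elim: p s => [a i x|p IHp q IHq|x p IHp|v p IHp] s /=.
- exact: agree_upd.
- apply: (@agree_trans _ _ (denote p s)).
    by apply: (agree_sub (IHp s)) => a; rewrite mem_cat => ->.
  by apply: (agree_sub (IHq _)) => a; rewrite mem_cat => ->; rewrite orbT.
- by case: ifP => // _.
- have hv s' i k : agree (v :: mods p) s' (upd s' v i k).
    by apply: (agree_sub (@agree_upd _ _ _ _)) => a; rewrite !inE => ->.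
  elim: (s 0 0) => [|n IHn] /=; first exact: hv.
  apply: (agree_trans IHn); apply: agree_trans (hv _ _ _).
  by apply: (agree_sub (IHp _)) => a ha; rewrite inE ha orbT.
Qed.

Lemma wf_mods0 p : wf p -> 0 \notin mods p.
Proof.
elim: p => [a i x|p IHp q IHq|x p IHp|v p IHp] //=.
- by rewrite inE eq_sym.
- by case/andP=> /IHp hp /IHq hq; rewrite mem_cat negb_or hp.
- by case/and3P=> hv _ /IHp hp; rewrite inE negb_or eq_sym hv.
Qed.

Lemma denote_n p s : wf p -> denote p s 0 = s 0.
Proof. by move=> /wf_mods0; apply: denote_agree. Qed.

(** Invariant rule for loops. Besides [P], an iteration may use the value of the counter and the
    frame condition relative to the store before the loop. *)
Lemma denote_for_ind v p s (P : nat -> store -> Prop) :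
  wf (PFor v p) ->
  P 0 (upd s v 0 0) ->
  (forall k s', k < s 0 0 -> P k s' -> s' v 0 = k -> agree (v :: mods p) s s' ->
     P k.+1 (upd (denote p s') v 0 k.+1)) ->
  P (s 0 0) (denote (PFor v p) s).
Proof.
move=> /= /and3P[v0 vp wp] P0 PS.
suff H k : k <= s 0 0 ->
    let s' := iter k (incr v \o denote p) (upd s v 0 0) in
    [/\ P k s', s' v 0 = k & agree (v :: mods p) s s'].
  by case: (H _ (leqnn _)).
elim: k => [|k IHk] hk /=.
  split=> //; first by rewrite upd_same.
  by apply: (agree_sub (@agree_upd _ _ _ _)) => a; rewrite !inE => ->.
have [P1 hv hag] := IHk (ltnW hk).
set s' := iter _ _ _ in P1 hv hag *.
have hv' : denote p s' v = s' v by apply: denote_agree.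
rewrite /incr hv' hv addn1; split; first exact: PS.
  by rewrite upd_same.
apply: (agree_trans hag); apply: (@agree_trans _ _ (denote p s')).
  by apply: (agree_sub (@denote_agree p s')) => a ha; rewrite inE ha orbT.
by apply: (agree_sub (@agree_upd _ _ _ _)) => a; rewrite !inE => ->.
Qed.

Lemma denote_sum v p acc s (F : nat -> nat) :
  wf (PFor v p) -> acc != v ->
  (forall k s', k < s 0 0 -> s' v 0 = k -> agree (v :: mods p) s s' ->
     denote p s' acc 0 = s' acc 0 + F k) ->
  denote (PFor v p) s acc 0 = s acc 0 + \sum_(k < s 0 0) F k.
Proof.
move=> wp av hF.
apply: (@denote_for_ind v p s
  (fun n s' => s' acc 0 = s acc 0 + \sum_(k < n) F k)) => //.
  by rewrite big_ord0 addn0 upd_other.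
move=> k s' hk IH hv hag; rewrite upd_other // (hF k) // IH.
by rewrite big_ord_recr /= addnA.
Qed.

(** * Running time of compiled programs *)

Definition runs_in (c : cmd) (s : store) (T : nat) (s' : store) : Prop :=
  exists2 t, exec c s t s' & t <= T.

(** Initialising the counter costs 3 and the last, failing test 6, which gives 9. An iteration costs
    the body plus 5 for the guard, 6 for the increment and 1 for the loop, within the allowance of
    14. *)
Lemma compile_for v p s T :
  wf (PFor v p) ->
  (forall s', s' 0 0 = s 0 0 -> runs_in (compile p) s' T (denote p s')) ->
  runs_in (compile (PFor v p)) s (s 0 0 * (T + 14) + 9) (denote (PFor v p) s).
Proof.
move=> /= /and3P[v0 vp wp] hp.
set n := s 0 0; set f := incr v \o denote p; set w := While _ _.
have f0 s' : f s' 0 = s' 0.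
  by rewrite /f /= /incr upd_other ?denote_n // eq_sym.
suff loop m : forall s', s' 0 0 = n -> s' v 0 + m = n ->
    runs_in w s' (m * (T + 14) + 6) (iter m f s').
  have := loop n (upd s v 0 0).
  rewrite upd_other ?upd_same 1?eq_sym // => /(_ erefl erefl) [t et ht].
  exists (3 + t); last by lia.
  by apply: ExecSeq et; apply: (ExecWr s v (Cst 0) (Cst 0)).
elim: m => [|m IH] s' h0 hv.
  exists 6; last by [].
  by apply: (@ExecWhileF (Sub (scalar 0) (scalar v))); rewrite /= h0 -hv; lia.
have hv1 : f s' v 0 = s' v 0 + 1.
  by rewrite /f /= /incr upd_same (denote_agree _ vp).
have [t1 e1 ht1] := hp s' h0.
have [||t2 e2 ht2] := IH (f s'); rewrite ?f0 ?hv1 //; first by lia.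
have c1 : cost (Sub (scalar 0) (scalar v)) = 5 by [].
exists (cost (Sub (scalar 0) (scalar v)) + (t1 + 6) + t2).+1; last first.
  by rewrite c1; lia.
rewrite iterSr; apply: ExecWhileT e2; first by rewrite /= h0; lia.
exact: ExecSeq e1 (ExecWr _ _ _ _).
Qed.

(** Sequencing adds the exponents and a loop raises the exponent by one. The base n + 1 keeps every
    power positive, so that constants can be absorbed. *)
Lemma compile_poly p : wf p -> exists c k, forall s,
  runs_in (compile p) s (c * (s 0 0).+1 ^ k) (denote p s).
Proof.
elim: p => [a i x|p IHp q IHq|x p IHp|v p IHp] /=.
- move=> _; exists (cost i + cost x).+1, 0 => s.
  by exists (cost i + cost x).+1; [exact: ExecWr | rewrite expn0 muln1].
- case/andP=> wp wq; have [c1 [k1 h1]] := IHp wp; have [c2 [k2 h2]] := IHq wq.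
  exists (c1 + c2), (k1 + k2) => s.
  have [t1 e1 ht1] := h1 s; have [t2 e2 ht2] := h2 (denote p s).
  exists (t1 + t2); first exact: ExecSeq e1 e2.
  rewrite denote_n // in ht2; rewrite mulnDl expnD.
  have g1 : 0 < (s 0 0).+1 ^ k1 by rewrite expn_gt0.
  have g2 : 0 < (s 0 0).+1 ^ k2 by rewrite expn_gt0.
  by apply: leq_add; [apply: leq_trans ht1 _|apply: leq_trans ht2 _]; nia.
- move=> wp; have [c [k h]] := IHp wp; exists (c + cost x + 2), k => s.
  have g1 : 0 < (s 0 0).+1 ^ k by rewrite expn_gt0.
  case: ifP => hx.
    have [t e ht] := h s; exists (cost x + t).+1; first exact: ExecIfT.
    by nia.
  exists (cost x + 1).+1; last by nia.
  by apply: ExecIfF; [apply/eqP; rewrite -[_ == _]negbK hx | exact: ExecSkip].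
- move=> /and3P[v0 vp wp]; have [c [k h]] := IHp wp.
  (* 23 = 14 + 9, the two constants of [compile_for]. *)
  exists (c + 23), k.+1 => s.
  have [|s' hs'|t e ht] := @compile_for v p s (c * (s 0 0).+1 ^ k).
  + by rewrite /= v0 vp.
  + by rewrite -hs'; apply: h.
  exists t; first exact: e.
  apply: leq_trans ht _; rewrite expnS.
  have g1 : 0 < (s 0 0).+1 ^ k by rewrite expn_gt0.
  by nia.
Qed.

(** * Requirements served by pairs of vertices *)

Lemma ohead_filter_iota (P : pred nat) n :
  match ohead [seq k <- iota 0 n | P k] with
  | Some k => [/\ k < n, P k & forall j, j < k -> ~~ P j]
  | None => forall j, j < n -> ~~ P j
  end.
Proof.
elim: n => [|n IHn] //.
rewrite -[n.+1]addn1 iotaD add0n filter_cat /=.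
case: [seq k <- iota 0 n | P k] IHn => [|k l] /= IHn; last first.
  by case: IHn => hk Pk hj; split=> //; rewrite addn1 ltnS ltnW.
case: ifP => [Pn|/negbT Pn] /=; first by split=> //; rewrite addn1.
by move=> j; rewrite addn1 ltnS leq_eqVlt => /orP[/eqP->|/IHn].
Qed.

Section Coverage.
Variables (V : finType) (e : rel V).
Implicit Types (D : {set V}) (u v w x y : V).

(** The vertices of a simple path are distinct, so the bounded search in [m_G] misses no path. *)
Lemma has_path_lt (f : rel V) u v k : has_path f u v k -> k < #|V|.
Proof.
case/existsP=> p /and3P[_ _ up].
rewrite -[k](size_tuple p) -[(size p).+1]/(size (u :: p)).
by rewrite -(card_uniqP up) max_card.
Qed.

Lemma m_G_le (f : rel V) u v b k :
  has_path f u v k -> k.-1 <= b -> le_fin (m_G f u v) b.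
Proof.
move=> hk kb; have := ohead_filter_iota (has_path f u v) #|V|.
rewrite /m_G; case: ohead => [j [_ _ hj]|/(_ k (has_path_lt hk))] /=.
  apply: leq_trans kb; case: (leqP j k) => [|/hj]; first by lia.
  by rewrite hk.
by rewrite hk.
Qed.

Lemma m_G_le_path (f : rel V) u v b :
  le_fin (m_G f u v) b -> exists2 k, k.-1 <= b & has_path f u v k.
Proof.
have := ohead_filter_iota (has_path f u v) #|V|.
by rewrite /m_G; case: ohead => [j [_ hj _]|] //= jb; exists j.
Qed.

(** Restricted to positive values because [predn] sends both lengths 0 and 1 to 0, where the length
    can no longer be recovered. *)
Lemma m_G_SomeP (f : rel V) u v k : m_G f u v = Some k.+1 <->
  has_path f u v k.+2 /\ (forall j, j < k.+2 -> ~~ has_path f u v j).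
Proof.
have := ohead_filter_iota (has_path f u v) #|V|.
rewrite /m_G; case: ohead => [j [_ hj jmin]|hj] /=; split=> //.
- by case: j hj jmin => [|[|j]] //= hj jmin [jk]; rewrite -jk.
- case=> hk kmin; case: (ltngtP j k.+2) => [/kmin|/jmin|->] //.
    by rewrite hj.
  by rewrite hk.
- by case=> hk _; have := hj _ (has_path_lt hk); rewrite hk.
Qed.

Lemma has_path0 (f : rel V) u v : has_path f u v 0 = (u == v).
Proof.
apply/existsP/idP => [[p]|uv]; first by rewrite (tuple0 p) /= andbT.
by exists [tuple]; rewrite /= uv.
Qed.

Lemma has_path1 (f : rel V) u v : has_path f u v 1 = f u v && (u != v).
Proof.
apply/existsP/andP => [[[[|x [|? ?]] //= _]]|[fuv uv]].
  by rewrite !inE !andbT => /and3P[fux /eqP <- ->].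
by exists [tuple v]; rewrite /= fuv eqxx inE uv.
Qed.

Lemma has_path2P (f : rel V) u v :
  reflect (exists x, [/\ f u x, f x v & uniq [:: u; x; v]]) (has_path f u v 2).
Proof.
apply: (iffP existsP) => [[[[|x [|y [|? ?]]] //= _]]|[x [fux fxv uq]]].
  case/and3P=> /and3P[fux fxy _] /eqP yv uq.
  by exists x; rewrite -yv fux fxy.
by exists [tuple x; v]; rewrite /= fux fxv eqxx.
Qed.

Lemma has_path3P (f : rel V) u v :
  reflect (exists x y, [/\ f u x, f x y, f y v & uniq [:: u; x; y; v]])
          (has_path f u v 3).
Proof.
apply: (iffP existsP) => [[[[|x [|y [|z [|? ?]]]] //= _]]|[x [y [fux fxy fyv uq]]]].
  case/and3P=> /and4P[fux fxy fyz _] /eqP zv uq.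
  by exists x, y; rewrite -zv fux fxy fyz.
by exists [tuple x; y; v]; rewrite /= fux fxy fyv eqxx.
Qed.

(* A triple (u, w, v) stands for the target couple [u, v] witnessed by the
   common neighbour w; the triples (u, w, u) stand for the domination of u. *)
Definition need u w v : bool := (u == v) || [&& ~~ e u v, e u w & e w v].

(** The first disjunct says that [x] dominates [u]. The second describes a walk u, x, y, v whose
    inner vertices may coincide; on the diagonal it still makes [x] a neighbour of [u]. *)
Definition hit u v x y : bool :=
  (u == v) && ((x == u) || e u x) || [&& e u x, (x == y) || e x y & e y v].

Definition hits D u v : bool := [exists x in D, exists y in D, hit u v x y].

Lemma hitsP D u v :
  reflect (exists x y, [/\ x \in D, y \in D & hit u v x y]) (hits D u v).
Proof.
apply: (iffP existsP) => [[x /andP[xD /existsP[y /andP[yD h]]]]|[x [y [xD yD h]]]].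
  by exists x, y.
by exists x; rewrite xD; apply/existsP; exists y; rewrite yD.
Qed.

Hypothesis ge : simple_graph e.

Let eirr : irreflexive e. Proof. by case: ge. Qed.

Lemma adj_neq u v : e u v -> u != v.
Proof. by apply: contraTneq => ->; rewrite eirr. Qed.

Lemma target_coupleP u v :
  reflect (exists w, [/\ u != v, ~~ e u v, e u w & e w v]) (target_couple e u v).
Proof.
apply: (iffP eqP) => [/m_G_SomeP[/has_path2P[w [uw wv _]] hj]|[w [uv nuv uw wv]]].
  have nuv := hj 0 isT; rewrite has_path0 in nuv.
  have := hj 1 isT; rewrite has_path1 nuv andbT => ne.
  by exists w.
apply/m_G_SomeP; split.
  apply/has_path2P; exists w.
  by rewrite /= !inE negb_or (adj_neq uw) (adj_neq wv) uv.
by case=> [|[|]] //; rewrite ?has_path0 ?has_path1 // (negbTE nuv).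
Qed.

(** At most 2 internal vertices means at most 3 edges. Lengths 0 and 1 are excluded, and the inner
    vertices of a simple path differ from [u] and [v], so they lie in [D] itself. *)
Lemma covers_hits D u v :
  u != v -> ~~ e u v -> covers e D u v = hits D u v.
Proof.
move=> uv nuv; have nuvf := negbTE nuv.
apply/idP/hitsP => [|[x [y [xD yD]]]].
  case/m_G_le_path=> -[|[|[|[|k]]]] // _.
  - by rewrite has_path0 (negbTE uv).
  - by rewrite has_path1 /induced /= nuvf !andbF.
  - case/has_path2P=> x [/and3P[_ xD ux] /and3P[_ _ xv]].
    rewrite /= !inE negb_or => /and3P[/andP[nux _] nxv _].
    move: xD; rewrite !inE (negbTE nxv) eq_sym (negbTE nux) !orbF => xD.
    by exists x, x; rewrite /hit ux xv eqxx /= orbT.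
  case/has_path3P=> x [y [/and3P[_ xD ux] /and3P[_ yD xy] /and3P[_ _ yv]]].
  rewrite /= !inE !negb_or => /and4P[/and3P[nux nuy _] /andP[_ nxv] nyv _].
  move: xD yD; rewrite !inE (negbTE nxv) (negbTE nyv).
  rewrite eq_sym (negbTE nux) eq_sym (negbTE nuy) !orbF => xD yD.
  by exists x, y; rewrite /hit ux xy yv !orbT.
rewrite /hit (negbTE uv) /= => /and3P[ux xy yv].
(* Since [u] and [v] are not adjacent, the walk u, x, y, v cannot meet its endpoints early, hence it
   is a simple path. *)
have nvx : x != v by apply: contraNneq nuv => <-.
have nuy : u != y by apply: contraNneq nuv => ->.
case/orP: xy => [/eqP exy|xy].
  subst y; apply: (@m_G_le _ _ _ _ 2) => //; apply/has_path2P; exists x.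
  by rewrite /induced /= !inE negb_or ux yv uv (adj_neq ux) nvx xD !eqxx !orbT.
apply: (@m_G_le _ _ _ _ 3) => //; apply/has_path3P; exists x, y.
rewrite /induced /= !inE !negb_or ux xy yv uv nuy nvx xD yD !eqxx !orbT.
by rewrite (adj_neq ux) (adj_neq xy) (adj_neq yv).
Qed.

Lemma dominated_hits D u :
  hits D u u = (u \in D) || [exists x in D, e u x].
Proof.
apply/hitsP/orP => [[x [y [xD _]]]|].
  rewrite /hit eqxx /= => h.
  have : (x == u) || e u x by case/orP: h => [//|/and3P[-> _ _]]; rewrite orbT.
  case/orP=> [/eqP<-|ux]; first by left.
  by right; apply/existsP; exists x; rewrite xD.
case=> [uD|/existsP[x /andP[xD ux]]].
  by exists u, u; rewrite /hit !eqxx.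
by exists x, x; rewrite /hit eqxx ux orbT.
Qed.

Lemma feasible_hits D :
  feasible e D <-> forall u w v, need u w v -> hits D u v.
Proof.
split=> [/andP[/forallP dom /forallP cov] u w v|H].
  have [<- _|uv /=] := eqVneq u v.
    rewrite dominated_hits; have := dom u.
    by case: (u \in D).
  rewrite /need (negbTE uv) /= => /and3P[nuv uw wv].
  rewrite -covers_hits //; have /forallP/(_ v)/implyP := cov u; apply.
  by apply/target_coupleP; exists w.
apply/andP; split.
  apply/forallP=> u; apply/implyP=> uD; have := H u u u.
  by rewrite /need eqxx dominated_hits (negbTE uD) => /(_ isT).
apply/forallP=> u; apply/forallP=> v.
apply/implyP=> /target_coupleP[w [uv nuv uw wv]].
by rewrite covers_hits // (H u w v) // /need nuv uw wv orbT.
Qed.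

(** * Counting served and unserved triples *)

Definition served D : {set V * V * V} :=
  [set t | need t.1.1 t.1.2 t.2 && hits D t.1.1 t.2].

Definition unserved D : {set V * V * V} :=
  [set t | need t.1.1 t.1.2 t.2 && ~~ hits D t.1.1 t.2].

Lemma hitsS D D' u v : D \subset D' -> hits D u v -> hits D' u v.
Proof.
move=> /fintype.subsetP s /hitsP[x [y [xD yD h]]]; apply/hitsP; exists x, y.
by rewrite !s.
Qed.

Lemma card_served D :
  #|served D| + #|unserved D| = #|[set t | need t.1.1 t.1.2 t.2]|.
Proof.
rewrite -cardsUI; set A := _ :&: _.
have -> : A = finset.set0.
  by apply/setP=> t; rewrite !inE; case: need; case: hits.
rewrite cards0 addn0; apply: eq_card => t; rewrite !inE.
by case: need; case: hits.
Qed.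

Lemma feasible_unserved D : feasible e D <-> #|unserved D| = 0.
Proof.
rewrite feasible_hits; split=> [H|/eqP].
  apply/eqP; rewrite cards_eq0; apply/eqP/setP=> -[[u w] v]; rewrite !inE /=.
  by apply/negbTE/negP=> /andP[/H ->].
rewrite cards_eq0 => /eqP/setP H u w v nd.
by have := H (u, w, v); rewrite !inE /= nd => /negbFE.
Qed.

Lemma unservedS D D' : D \subset D' -> unserved D' \subset unserved D.
Proof.
move=> s; apply/fintype.subsetP=> t; rewrite !inE => /andP[-> h] /=.
by apply: contra h; apply: hitsS.
Qed.

Lemma servedS D D' : D \subset D' -> #|served D| <= #|served D'|.
Proof.
move=> s; have := subset_leq_card (unservedS s).
by have := card_served D; have := card_served D'; lia.
Qed.

(* The pairs of a feasible set serve every triple, so some pair serves at least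
   a fraction 1 / #|Dopt|^2 of the unserved triples. *)
Lemma best_pair_gain D D' Dopt : feasible e Dopt ->
  (forall x y, #|served (D :|: [set x; y])| <= #|served D'|) ->
  #|unserved D| + #|Dopt| ^ 2 * #|unserved D'| <= #|Dopt| ^ 2 * #|unserved D|.
Proof.
move=> /feasible_hits feas best.
(* [U x y] holds the triples newly served by the pair. None is larger than the gain of [D'], while
   the pairs of [Dopt] together cover all open triples; the union bound concludes. *)
pose U x y := unserved D :\: unserved (D :|: [set x; y]).
have leU x y : #|U x y| + #|unserved D'| <= #|unserved D|.
  have := best x y; have := card_served D'; have := card_served (D :|: [set x; y]).
  have : unserved (D :|: [set x; y]) \subset unserved D.
    exact/unservedS/finset.subsetUl.
  move/cardsDS; rewrite /U => ->; have := card_served D.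
  by have := servedS (finset.subsetUl D [set x; y]); lia.
have subU : unserved D \subset \bigcup_(z in finset.setX Dopt Dopt) U z.1 z.2.
  apply/fintype.subsetP=> -[[u w] v] tD; have := tD; rewrite inE /= => /andP[nd _].
  have /hitsP[x [y [xD yD h]]] := feas _ _ _ nd.
  apply/finset.bigcupP; exists (x, y); first by rewrite finset.in_setX xD.
  rewrite inE tD andbT inE /= nd /= negbK; apply/hitsP; exists x, y.
  by rewrite !inE !eqxx !orbT.
have : #|unserved D| <= \sum_(z in finset.setX Dopt Dopt) #|U z.1 z.2|.
  apply: leq_trans (subset_leq_card subU) _.
  elim/big_rec2: _ => [|z n A _ IH]; first by rewrite cards0.
  by apply: leq_trans (leq_card_setU _ _) _; rewrite leq_add2l.
move=> hU.
have : \sum_(z in finset.setX Dopt Dopt) (#|U z.1 z.2| + #|unserved D'|) <=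
       \sum_(z in finset.setX Dopt Dopt) #|unserved D|.
  by apply: leq_sum => z _; apply: leU.
rewrite big_split /= !sum_nat_const cardsX mulnn; apply: leq_trans.
by rewrite leq_add2r.
Qed.

End Coverage.

(** Division-free form of u' <= (1 - 1/K) u. *)
Lemma gain_decay K u u' :
  u + K * u' <= K * u -> 0 < u -> K * u' <= K.-1 * u.
Proof. by case: K => [|K] /=; rewrite ?mulSn; nia. Qed.

(** * Feasibility and size of greedily built sets *)

Section Greedy.
Variables (V : finType) (e : rel V) (o : V).
Implicit Types (D : {set V}) (x y : V).

(** The last clause concerns idle steps: the number of steps is fixed in advance, so a step without
    gain must not enlarge the set beyond the one spare vertex [o]. *)
Definition greedy_step D D' : Prop :=
  exists x y, [/\ D' = D :|: [set x; y],
    forall x' y', #|served e (D :|: [set x'; y'])| <= #|served e D'|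
    & #|served e D'| = #|served e D| -> D' \subset o |: D].

Inductive greedy_reach : nat -> {set V} -> Prop :=
| GreedyStart : greedy_reach 0 finset.set0
| GreedyNext t D D' :
    greedy_reach t D -> greedy_step D D' -> greedy_reach t.+1 D'.

Hypothesis ge : simple_graph e.

Lemma card_unserved_le D : #|unserved e D| <= #|V| ^ 3.
Proof.
by apply: leq_trans (max_card _) _; rewrite !card_prod !expnS expn0 muln1 mulnA.
Qed.

Lemma greedy_step_unserved D D' : greedy_step D D' ->
  #|unserved e D'| <= #|unserved e D|.-1.
Proof.
case=> x [y [defD' best _]].
(* Comparison with the feasible full vertex set shows that an open triple forces a strict gain. *)
have := best_pair_gain ge (feasible_setT e) best.
have [u0|u_gt0 hU] := posnP #|unserved e D|.
  have := subset_leq_card (@unservedS _ e _ _ (finset.subsetUl D [set x; y])).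
  by rewrite -defD' u0.
by case: leqP => //; nia.
Qed.

Lemma greedy_unserved t D : greedy_reach t D -> #|unserved e D| <= #|V| ^ 3 - t.
Proof.
elim=> {t D} [|t D D' _ IH /greedy_step_unserved]; last by lia.
by rewrite subn0 card_unserved_le.
Qed.

Lemma greedy_feasible D : greedy_reach (#|V| ^ 3) D -> feasible e D.
Proof.
move/greedy_unserved; rewrite subnn leqn0 => /eqP u0.
exact/(feasible_unserved ge).
Qed.

(* i + 1 bounds the number of steps that served a new triple; each of them
   multiplies the number of unserved triples by at most 1 - 1/K. *)
Lemma greedy_size t D Dopt : greedy_reach t D -> feasible e Dopt ->
  let K := #|Dopt| ^ 2 in
  exists i, #|D| <= 2 * i + 3 /\ K ^ i <= K.-1 ^ i * #|V| ^ 3.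
Proof.
move=> rD feas K.
(* Here [j] counts the steps begun with an open triple, and [o] is counted from the start so that
   idle steps are free. The decay inequality is also recorded for j - 1, just before the last such
   step, when at least one triple was open. *)
suff [j [cD _ hj]] : exists j, [/\ #|o |: D| <= 2 * j + 1,
    K ^ j * #|unserved e D| <= K.-1 ^ j * #|V| ^ 3
    & j = 0 \/ K ^ j.-1 <= K.-1 ^ j.-1 * #|V| ^ 3].
  (* For j > 0, 2 j + 1 = 2 (j - 1) + 3, which is the source of the additive 3. *)
  exists j.-1; split.
    by have := subset_leq_card (finset.subsetUr [set o] D); lia.
  case: hj => [->|//]; rewrite !expn0 mul1n expn_gt0; apply/orP; left.
  by apply/card_gt0P; exists o.
elim: rD => {t D} [|t D D' _ [j [cD uD hj]] hstep].
  exists 0; split; [|by rewrite !expn0 !mul1n card_unserved_le|by left].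
  by rewrite finset.setU0 cards1.
have [x [y [defD' best same]]] := hstep.
have hK := best_pair_gain ge feas best; rewrite -/K in hK.
have le_u := greedy_step_unserved hstep.
(* With nothing left to serve the step is idle and [j] stays; otherwise [j] grows by one. *)
have [u0|u_gt0] := posnP #|unserved e D|.
  have u0' : #|unserved e D'| = 0.
    by apply/eqP; rewrite -leqn0 (leq_trans le_u) // u0.
  have /same sD : #|served e D'| = #|served e D|.
    have := card_served e D'; rewrite u0' addn0 => ->.
    by rewrite -(card_served e D) u0 addn0.
  exists j; split=> //; last by rewrite u0' muln0.
  apply: leq_trans cD; apply: subset_leq_card.
  by rewrite finset.subUset sD finset.subsetUl.
have hK' := gain_decay hK u_gt0.
exists j.+1; split.
- rewrite defD' finset.setUA; apply: leq_trans (leq_card_setU _ _) _.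
  rewrite cards2 mulnS [2 + _]addnC addnAC; apply: leq_add cD _.
  by case: (x != y).
- rewrite (expnS K) (expnS K.-1) -mulnA mulnCA.
  apply: leq_trans (leq_mul (leqnn _) hK') _.
  rewrite mulnCA -[X in _ <= X]mulnA; exact: leq_mul.
- right => /=; apply: leq_trans uD.
  by rewrite leq_pmulr.
Qed.

End Greedy.

Lemma opt_feasible (V : finType) (e : rel V) :
  exists2 D : {set V}, feasible e D & #|D| = opt e.
Proof.
rewrite /opt; case: arg_minnP; first exact: feasible_setT.
by move=> D hD _; exists D.
Qed.

Lemma opt_gt0 (V : finType) (e : rel V) : 0 < #|V| -> 0 < opt e.
Proof.
move=> /card_gt0P[v _].
have [D /andP[/forallP/(_ v) dom _] <-] := opt_feasible e.
apply/card_gt0P.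
case: (boolP (v \in D)) dom => [vD _|_ /existsP[u /andP[uD _]]].
  by exists v.
by exists u.
Qed.

(** * The greedy program *)

(* Cell u of array row_ holds u * n, as the machine cannot multiply; the other
   arrays named here are used as scalars, through their cell 0. *)
Local Notation row_ := 3.
Local Notation u_ := 4.
Local Notation w_ := 5.
Local Notation v_ := 6.
Local Notation x_ := 7.
Local Notation y_ := 8.
Local Notation p_ := 9.
Local Notation q_ := 10.
Local Notation cnt_ := 11.
Local Notation acc_ := 12.
Local Notation best_ := 13.
Local Notation bp_ := 14.
Local Notation bq_ := 15.
Local Notation i_ := 16.
Local Notation j_ := 17.
Local Notation k_ := 18.

(** Booleans are the numbers 0 and 1, and the connectives rely on truncated subtraction. *)
Definition notE (a : expr) : expr := Sub (Cst 1) a.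
Definition andE (a b : expr) : expr := Sub (Add a b) (Cst 1).
Definition orE (a b : expr) : expr := notE (Sub (notE a) b).
(** The sum of the two truncated differences is the distance of the two values, zero exactly when
    they agree. *)
Definition eqE (a b : nat) : expr :=
  notE (Add (Sub (scalar a) (scalar b)) (Sub (scalar b) (scalar a))).
Definition adjE (a b : nat) : expr :=
  Rd 1 (Add (Rd row_ (scalar a)) (scalar b)).
(** Membership in the current set enlarged by the candidate pair, which is thus tested without being
    written to array 2. *)
Definition memE (a : nat) : expr :=
  orE (Rd 2 (scalar a)) (orE (eqE a p_) (eqE a q_)).
Definition needE : expr :=
  orE (eqE u_ v_) (andE (notE (adjE u_ v_)) (andE (adjE u_ w_) (adjE w_ v_))).
Definition hitE : expr :=
  orE (andE (eqE u_ v_) (orE (eqE x_ u_) (adjE u_ x_)))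
      (andE (adjE u_ x_) (andE (orE (eqE x_ y_) (adjE x_ y_)) (adjE y_ v_))).

Definition row_table : prog :=
  PFor u_ (PWr row_ (Add (scalar u_) (Cst 1)) (Add (Rd row_ (scalar u_)) (scalar 0))).
Definition count_hits : prog :=
  PFor x_ (PFor y_
    (PSet cnt_ (Add (scalar cnt_) (andE (memE x_) (andE (memE y_) hitE))))).
(* The truncated difference n - (n - c) is the minimum of n and c. *)
Definition count_triple : prog :=
  PSeq (PSet cnt_ (Cst 0)) (PSeq count_hits
    (PSet acc_ (Add (scalar acc_) (Sub needE (Sub needE (scalar cnt_)))))).
Definition count_served : prog :=
  PSeq (PSet acc_ (Cst 0)) (PFor u_ (PFor w_ (PFor v_ count_triple))).
Definition try_pair : prog :=
  PSeq count_served (PIf (Sub (scalar acc_) (scalar best_))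
    (PSeq (PSet best_ (scalar acc_))
       (PSeq (PSet bp_ (scalar p_)) (PSet bq_ (scalar q_))))).
Definition search : prog := PFor p_ (PFor q_ try_pair).
Definition step : prog :=
  PSeq search (PSeq (PWr 2 (scalar bp_) (Cst 1)) (PWr 2 (scalar bq_) (Cst 1))).
(* best_, bp_ and bq_ keep their values from one step to the next: once all
   triples are served, a step can add nothing but the vertex 0. *)
Definition greedy : prog := PSeq row_table (PFor i_ (PFor j_ (PFor k_ step))).

(** * Evaluation of expressions and loops *)

Section Booleans.
Variables (s : store) (a b : expr) (ba bb : bool).
Hypotheses (ha : eval s a = ba) (hb : eval s b = bb).

Lemma eval_notE : eval s (notE a) = ~~ ba.
Proof. by rewrite /= ha; case: ba. Qed.

Lemma eval_andE : eval s (andE a b) = ba && bb.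
Proof. by rewrite /= ha hb; case: ba; case: bb. Qed.

Lemma eval_orE : eval s (orE a b) = ba || bb.
Proof. by rewrite /= ha hb; case: ba; case: bb. Qed.

End Booleans.

Lemma denote_set a x s : denote (PSet a x) s a 0 = eval s x.
Proof. exact: upd_same. Qed.

Lemma evalD s x y : eval s (Add x y) = eval s x + eval s y.
Proof. by []. Qed.

Lemma evalB s x y : eval s (Sub x y) = eval s x - eval s y.
Proof. by []. Qed.

Lemma denote_seq p q s : denote (PSeq p q) s = denote q (denote p s).
Proof. by []. Qed.

Lemma denote_sum_ord n v p acc s (F : 'I_n -> nat) :
  wf (PFor v p) -> acc != v -> s 0 0 = n ->
  (forall (k : 'I_n) (s' : store), s' v 0 = k -> agree (v :: mods p) s s' ->
     denote p s' acc 0 = s' acc 0 + F k) ->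
  denote (PFor v p) s acc 0 = s acc 0 + \sum_(k < n) F k.
Proof.
move=> wp av sn hF.
(* The default 0 is never reached, since the counter stays below [n]. *)
rewrite (@denote_sum v p acc s (fun k => oapp F 0 (insub k))) //.
  rewrite sn; congr (_ + _); apply: eq_bigr => k _.
  by rewrite (valK k).
rewrite sn => k s' hk hv hag; rewrite (insubT (fun i => i < n) hk) /=.
exact: (hF (Ordinal hk)).
Qed.

(** The index of [P] counts elementary steps: a body worth [m] steps makes the loop worth n m.
    Nested loops therefore multiply their counts. *)
Lemma denote_for_count n v p m (P : nat -> store -> Prop) t s :
  wf (PFor v p) -> s 0 0 = n ->
  (forall t s i, P t s -> P t (upd s v 0 i)) ->
  (forall t s, s 0 0 = n -> P t s -> P (t + m) (denote p s)) ->
  P t s -> P (t + n * m) (denote (PFor v p) s).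
Proof.
move=> wp sn Pupd Pp Pt.
have := @denote_for_ind v p s (fun k s' => P (t + k * m) s') wp.
rewrite sn; apply; first by rewrite mul0n addn0; apply: Pupd.
move=> k s' _ Pk _ hag; apply: Pupd; rewrite mulSnr addnA; apply: Pp => //.
by rewrite hag // (wf_mods0 wp).
Qed.

(** * The program counts the served triples *)

Section Correctness.
Variables (n : nat) (e : rel 'I_n).
Implicit Types (s : store) (D : {set 'I_n}) (u v w x y p q : 'I_n).

Definition graph_in s : Prop :=
  [/\ s 0 0 = n, forall u v, s 1 (u * n + v) = e u v & forall u, s row_ u = u * n].

Definition set_in D s : Prop := forall x, s 2 x = (x \in D).

Lemma graph_in_agree l s s' : agree l s s' ->
  [&& 0 \notin l, 1 \notin l & row_ \notin l] -> graph_in s -> graph_in s'.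
Proof. by rewrite /graph_in => h /and3P[/h -> /h -> /h ->]. Qed.

Lemma set_in_agree l D s s' : agree l s s' -> 2 \notin l ->
  set_in D s -> set_in D s'.
Proof. by rewrite /set_in => h /h ->. Qed.

Lemma eval_eqE s a b u v : s a 0 = u -> s b 0 = v -> eval s (eqE a b) = (u == v).
Proof. by rewrite /= => -> ->; rewrite -val_eqE /=; lia. Qed.

Lemma eval_adjE s a b u v : graph_in s -> s a 0 = u -> s b 0 = v ->
  eval s (adjE a b) = e u v.
Proof. by case=> _ h1 h3 /= -> ->; rewrite h3 h1. Qed.

Lemma eval_memE s D a p q x : set_in D s -> s p_ 0 = p -> s q_ 0 = q ->
  s a 0 = x -> eval s (memE a) = (x \in D :|: [set p; q]).
Proof.
move=> hD hp hq hx; rewrite /memE.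
rewrite (eval_orE (bb := (x == p) || (x == q)) (ba := x \in D)) ?inE //.
  by rewrite /= hx hD.
by apply: eval_orE; apply: eval_eqE.
Qed.

Lemma eval_needE s u w v : graph_in s -> s u_ 0 = u -> s w_ 0 = w -> s v_ 0 = v ->
  eval s needE = need e u w v.
Proof.
move=> hg hu hw hv; apply: eval_orE; first exact: eval_eqE.
apply: eval_andE; first by apply: eval_notE; apply: eval_adjE.
by apply: eval_andE; apply: eval_adjE.
Qed.

Lemma eval_hitE s u v x y : graph_in s -> s u_ 0 = u -> s v_ 0 = v ->
  s x_ 0 = x -> s y_ 0 = y -> eval s hitE = hit e u v x y.
Proof.
move=> hg hu hv hx hy; apply: eval_orE; apply: eval_andE.
- exact: eval_eqE.
- by apply: eval_orE; [apply: eval_eqE | apply: eval_adjE].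
- exact: eval_adjE.
apply: eval_andE; last exact: eval_adjE.
by apply: eval_orE; [apply: eval_eqE | apply: eval_adjE].
Qed.

Lemma denote_count_hits s D p q u v : graph_in s -> set_in D s ->
  s p_ 0 = p -> s q_ 0 = q -> s u_ 0 = u -> s v_ 0 = v ->
  let D' := D :|: [set p; q] in
  denote count_hits s cnt_ 0 = s cnt_ 0 +
    \sum_(x < n) \sum_(y < n) [&& x \in D', y \in D' & hit e u v x y].
Proof.
move=> hg hD hp hq hu hv D'.
apply: denote_sum_ord => //; first by case: hg.
move=> x s1 hx a1; apply: denote_sum_ord => //.
  by rewrite (a1 0) //; case: hg.
move=> y s2 hy a2; rewrite denote_set evalD.
have hg2 : graph_in s2.
  by apply: (graph_in_agree a2) => //; apply: (graph_in_agree a1).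
have hD2 : set_in D s2.
  by apply: (set_in_agree a2) => //; apply: (set_in_agree a1).
have [hp2 hq2] : s2 p_ 0 = p /\ s2 q_ 0 = q by rewrite !a2 // !a1.
have [hu2 hv2] : s2 u_ 0 = u /\ s2 v_ 0 = v by rewrite !a2 // !a1.
have hx2 : s2 x_ 0 = x by rewrite a2.
congr (_ + _); apply: eval_andE; first exact: eval_memE.
by apply: eval_andE; [apply: eval_memE | apply: eval_hitE].
Qed.

Lemma sum_hits D u v :
  hits e D u v =
  (0 < \sum_(x < n) \sum_(y < n) [&& x \in D, y \in D & hit e u v x y]).
Proof.
apply/hitsP/idP => [[x [y [xD yD h]]]|].
  by rewrite (bigD1 x) //= (bigD1 y) //= xD yD h.
rewrite lt0n sum_nat_eq0 => /forallPn[x]; rewrite sum_nat_eq0 => /forallPn[y].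
by case: and3P => // -[xD yD h] _; exists x, y.
Qed.

Lemma denote_count_triple s D p q u w v : graph_in s -> set_in D s ->
  s p_ 0 = p -> s q_ 0 = q -> s u_ 0 = u -> s w_ 0 = w -> s v_ 0 = v ->
  denote count_triple s acc_ 0 =
    s acc_ 0 + (need e u w v && hits e (D :|: [set p; q]) u v).
Proof.
move=> hg hD hp hq hu hw hv.
rewrite /count_triple !denote_seq denote_set evalD (evalB _ needE) (evalB _ needE).
set s1 := denote _ s; set s2 := denote _ s1.
have a1 : agree [:: cnt_] s s1 by exact: (@denote_agree (PSet cnt_ (Cst 0))).
have a2 : agree (mods count_hits) s1 s2 by exact: denote_agree.
have hg1 : graph_in s1 by apply: (graph_in_agree a1).
have hD1 : set_in D s1 by apply: (set_in_agree a1).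
have hg2 : graph_in s2 by apply: (graph_in_agree a2).
have hneed : eval s2 needE = need e u w v.
  by apply: eval_needE; rewrite // a2 // a1.
have -> : eval s2 (scalar acc_) = s acc_ 0 by rewrite /= a2 // a1.
rewrite hneed sum_hits; have -> : eval s2 (scalar cnt_) =
    \sum_(x < n) \sum_(y < n) [&& x \in D :|: [set p; q],
      y \in D :|: [set p; q] & hit e u v x y].
  have c0 : s1 cnt_ 0 = 0 by exact: upd_same.
  rewrite -[LHS]/(denote count_hits s1 cnt_ 0).
  by rewrite (@denote_count_hits s1 D p q u v) ?c0 // a1.
(* The minimum of a 0/1 value and the number of hitting pairs is 1 exactly when the triple is needed
   and some pair hits it. *)
by congr (_ + _); case: need => /=; lia.
Qed.

Lemma card_served_sum D :
  #|served e D| = \sum_u \sum_w \sum_v (need e u w v && hits e D u v).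
Proof.
rewrite pair_bigA pair_bigA -sum1_card big_mkcond /=.
by apply: eq_bigr => t _; rewrite inE; case: andP.
Qed.

Lemma denote_count_served s D p q : graph_in s -> set_in D s ->
  s p_ 0 = p -> s q_ 0 = q ->
  denote count_served s acc_ 0 = #|served e (D :|: [set p; q])|.
Proof.
move=> hg0 hD0 hp0 hq0; rewrite card_served_sum.
rewrite /count_served denote_seq; set s0 := denote _ s.
have a0 : agree [:: acc_] s s0 by exact: (@denote_agree (PSet acc_ (Cst 0))).
have hg : graph_in s0 by apply: (graph_in_agree a0).
have hD : set_in D s0 by apply: (set_in_agree a0).
have hp : s0 p_ 0 = p by rewrite a0.
have hq : s0 q_ 0 = q by rewrite a0.
rewrite (@denote_sum_ord n u_ _ acc_ s0 (fun u =>
  \sum_w \sum_v (need e u w v && hits e (D :|: [set p; q]) u v))) ?denote_set //.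
  by case: hg.
move=> u s1 hu a1.
have hg1 : graph_in s1 by apply: (graph_in_agree a1).
have hD1 : set_in D s1 by apply: (set_in_agree a1).
have [hp1 hq1] : s1 p_ 0 = p /\ s1 q_ 0 = q by rewrite !a1.
apply: denote_sum_ord => //; first by case: hg1.
move=> w s2 hw a2.
have hg2 : graph_in s2 by apply: (graph_in_agree a2).
have hD2 : set_in D s2 by apply: (set_in_agree a2).
have [hp2 hq2] : s2 p_ 0 = p /\ s2 q_ 0 = q by rewrite !a2.
have hu2 : s2 u_ 0 = u by rewrite a2.
apply: denote_sum_ord => //; first by case: hg2.
move=> v s3 hv a3; apply: denote_count_triple => //; rewrite ?a3 //.
- by apply: (graph_in_agree a3).
- by apply: (set_in_agree a3).
Qed.

End Correctness.

(** * The program simulates the greedy construction *)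

Section Greedy_correctness.
Variables (n : nat) (e : rel 'I_n) (o : 'I_n).
Implicit Types (s : store) (D : {set 'I_n}) (x y p q : 'I_n).

(** [seen] marks the pairs already tried. Either no pair has improved on [D] and the remembered pair
    adds at most [o], or the remembered pair attains the record and strictly improves on [D]. *)
Definition search_inv D (seen : 'I_n -> 'I_n -> bool) s : Prop :=
  (forall x y, seen x y -> #|served e (D :|: [set x; y])| <= s best_ 0) /\
  exists p q, [/\ s bp_ 0 = p, s bq_ 0 = q
    & [/\ s best_ 0 = #|served e D|, p \in o |: D & q \in o |: D] \/
      (s best_ 0 = #|served e (D :|: [set p; q])| /\ #|served e D| < s best_ 0)].

Lemma search_inv_eq D seen seen' s s' :
  s' best_ = s best_ -> s' bp_ = s bp_ -> s' bq_ = s bq_ -> seen' =2 seen ->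
  search_inv D seen s -> search_inv D seen' s'.
Proof.
by rewrite /search_inv => -> -> -> h [h1 h2]; split=> // x y; rewrite h; apply: h1.
Qed.

Lemma denote_try_pair D p q seen s : graph_in e s -> set_in D s ->
  s p_ 0 = p -> s q_ 0 = q -> search_inv D seen s ->
  search_inv D (fun x y => seen x y || (x == p) && (y == q)) (denote try_pair s).
Proof.
move=> hg hD hp hq [leB [p0 [q0 [hp0 hq0 hbest]]]].
rewrite /try_pair denote_seq; set s1 := denote _ s.
have hacc : s1 acc_ 0 = #|served e (D :|: [set p; q])|.
  exact: denote_count_served.
have a1 : agree (mods count_served) s s1 by exact: denote_agree.
have [hb1 hp1 hq1] : [/\ s1 best_ = s best_, s1 bp_ = s bp_ & s1 bq_ = s bq_].
  by rewrite !a1.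
have [hpp hqq] : s1 p_ 0 = p /\ s1 q_ 0 = q by rewrite !a1.
rewrite [denote _ s1]/= -lt0n subn_gt0 /search_inv.
case: ltnP => hlt; last first.
  rewrite hb1 hp1 hq1; split; last by exists p0, q0.
  move=> x y /orP[/leB //|/andP[/eqP-> /eqP->]].
  by rewrite -hacc -hb1.
rewrite /upd /= hacc hpp hqq; rewrite hb1 hacc in hlt.
(* The record never falls below the count for [D], so a new record is a strict gain over [D]. *)
have hD1 : #|served e D| <= s best_ 0 by case: hbest => [[-> _ _]|[_ /ltnW]].
split; last by exists p, q; split=> //; right; split=> //; apply: leq_ltn_trans hlt.
move=> x y /orP[/leB h|/andP[/eqP-> /eqP->]] //.
exact: leq_trans h (ltnW hlt).
Qed.

(** The tried pairs form a prefix of the lexicographic order: all x < k in the outer loop, and in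
    addition x = k with y < l in the inner one. *)
Lemma denote_search D s : graph_in e s -> set_in D s ->
  search_inv D (fun _ _ => false) s ->
  search_inv D (fun _ _ => true) (denote search s).
Proof.
move=> hg hD hinv.
have sn : s 0 0 = n by case: hg.
have := @denote_for_ind p_ (PFor q_ try_pair) s
  (fun k s' => search_inv D (fun x _ => x < k) s') isT.
rewrite sn => H; apply: (@search_inv_eq D (fun x _ => x < n) _ (denote search s)) => //.
  by move=> x y; rewrite ltn_ord.
apply: H; first by apply: search_inv_eq hinv.
move=> k s1 hk inv1 hp a1.
have hg1 : graph_in e s1 by apply: (graph_in_agree a1).
have hD1 : set_in D s1 by apply: (set_in_agree a1).
have sn1 : s1 0 0 = n by case: hg1.
pose p := Ordinal hk.
have := @denote_for_ind q_ try_pair s1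
  (fun l s' => search_inv D (fun x y => (x < k) || (x == p) && (y < l)) s') isT.
rewrite sn1 => H.
apply: (@search_inv_eq D (fun x y => (x < k) || (x == p) && (y < n)) _
         (denote (PFor q_ try_pair) s1)) => //.
  by move=> x y; rewrite ltn_ord andbT ltnS leq_eqVlt orbC -val_eqE.
apply: H.
  by apply: search_inv_eq inv1 => // x y; rewrite ltn0 andbF orbF.
move=> l s2 hl inv2 hq a2.
pose q := Ordinal hl.
apply: (@search_inv_eq D
  (fun x y => ((x < k) || (x == p) && (y < l)) || (x == p) && (y == q)) _
  (denote try_pair s2)) => //.
  by move=> x y; rewrite ltnS [y <= l]leq_eqVlt -orbA -andb_orr [_ || (y == q)]orbC.
apply: denote_try_pair => //.
- by apply: (graph_in_agree a2).
- by apply: (set_in_agree a2).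
- by rewrite a2.
Qed.

Definition step_inv D s : Prop :=
  [/\ graph_in e s, set_in D s, s best_ 0 = #|served e D|
    & exists p q, [/\ s bp_ 0 = p, s bq_ 0 = q, p \in o |: D & q \in o |: D]].

Lemma denote_step D s : step_inv D s ->
  exists2 D', greedy_step e o D D' & step_inv D' (denote step s).
Proof.
case=> hg hD hbest [p0 [q0 [hp0 hq0 p0D q0D]]].
rewrite /step denote_seq; set s1 := denote search s.
have a1 : agree (mods search) s s1 by exact: denote_agree.
have hg1 : graph_in e s1 by apply: (graph_in_agree a1).
have hD1 : set_in D s1 by apply: (set_in_agree a1).
have [|best [p [q [hp hq hpq]]]] := @denote_search D s hg hD.
  by split=> //; exists p0, q0; split=> //; left.
rewrite -/s1 in best hp hq hpq.
set D' := D :|: [set p; q].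
have hbest1 : s1 best_ 0 = #|served e D'|.
  (* Without improvement the record is still the count for [D]; it bounds the count for the superset
     [D'], which forces equality. *)
  case: hpq => [[hb _ _]|[//]].
  apply/eqP; rewrite eqn_leq best // andbT hb.
  exact/servedS/finset.subsetUl.
have pqD : #|served e D'| = #|served e D| -> D' \subset o |: D.
  case: hpq => [[_ pD qD] _|[_ hlt heq]].
    by rewrite !finset.subUset finset.subsetUr !finset.sub1set pD.
  by rewrite hbest1 heq ltnn in hlt.
exists D'.
  by exists p, q; split=> // x y; rewrite -hbest1; apply: best.
set s2 := denote _ s1.
have a2 : agree [:: 2; 2] s1 s2.
  exact: (@denote_agree (PSeq (PWr 2 _ _) (PWr 2 _ _))).
split.
- exact: (graph_in_agree a2).
- move=> x; rewrite /s2 /= /upd /= hp hq !inE -!val_eqE /=.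
  by rewrite hD1; case: (x == q :> nat); case: (x == p :> nat); rewrite ?orbT // !orbF.
- by rewrite a2.
(* The remembered pair now lies in the new set, so repeating it in an idle step is harmless. *)
by exists p, q; rewrite !a2 // !inE !eqxx !orbT.
Qed.

Lemma denote_row_table s : s 0 0 = n -> s row_ 0 = 0 ->
  forall u : 'I_n, denote row_table s row_ u = u * n.
Proof.
move=> sn s0 u.
have := @denote_for_ind u_
  (PWr row_ (Add (scalar u_) (Cst 1)) (Add (Rd row_ (scalar u_)) (scalar 0))) s
  (fun k s' => forall i, i <= k -> s' row_ i = i * n) isT.
rewrite sn; apply; last exact: ltnW.
  by case=> // _; rewrite upd_other.
move=> k s1 hk IH hu a1 i; rewrite upd_other //= hu (a1 0) // sn IH //.
rewrite /upd eqxx /= addn1.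
by case: eqP => [->|ne hi]; [rewrite mulSnr | apply: IH; lia].
Qed.

(** Quotient and remainder modulo [n] recover the row and the column from a cell index. *)
Lemma graph_input_adj (u v : 'I_n) : graph_input e 1 (u * n + v) = e u v.
Proof.
rewrite /graph_input; congr nat_of_bool; apply/existsP/idP => [[u' /existsP[v']]|uv].
  case/andP=> /eqP h; suff [-> -> //] : u = u' /\ v = v'.
  split; apply: val_inj => /=.
    have := congr1 (fun m => m %/ n) h.
    rewrite !divnMDl ?(leq_trans _ (ltn_ord u)) //.
    by rewrite !divn_small ?addn0.
  have := congr1 (fun m => m %% n) h.
  by rewrite !modnMDl !modn_small.
by exists u; apply/existsP; exists v; rewrite eqxx.
Qed.

Hypothesis o0 : o = 0 :> nat.

(** Fresh cells hold 0: this is the number of triples served by the empty set, and it makes the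
    initial remembered pair twice the vertex 0, that is [o]. *)
Lemma step_inv_input : step_inv finset.set0 (denote row_table (graph_input e)).
Proof.
set s := denote _ _.
have a : agree (mods row_table) (graph_input e) s by exact: denote_agree.
split.
- split; first by rewrite a.
    by move=> u v; rewrite a // graph_input_adj.
  exact: denote_row_table.
- by move=> x; rewrite a // inE.
- rewrite a //=; apply/esym/eqP; rewrite cards_eq0; apply/eqP/setP=> t.
  rewrite !inE; apply/negbTE; rewrite negb_and; apply/orP; right.
  by apply/hitsP=> -[x [y []]]; rewrite inE.
by exists o, o; rewrite !a //= o0 !inE eqxx.
Qed.

Lemma denote_greedy :
  exists2 D, greedy_reach e o (n ^ 3) D
           & set_output n (denote greedy (graph_input e)) = D.
Proof.
pose P t s := exists2 D, greedy_reach e o t D & step_inv D s.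
have Pupd v i t s : v \in [:: i_; j_; k_] -> P t s -> P t (upd s v 0 i).
  move=> hv [D rD [hg hD hb hpq]]; exists D => //.
  have a : agree [:: i_; j_; k_] s (upd s v 0 i).
    apply: (agree_sub (@agree_upd _ _ _ _)) => b.
    by rewrite inE => /eqP ->.
  split; rewrite ?a //; first exact: (graph_in_agree a).
  exact: (set_in_agree a).
have P1 t s : P t s -> P (t + 1) (denote step s).
  rewrite addn1 => -[D rD /denote_step[D' st inv]]; exists D' => //.
  exact: GreedyNext rD st.
have [D rD [_ hD _ _]] : P (n ^ 3) (denote greedy (graph_input e)).
  rewrite /greedy denote_seq -[n ^ 3]add0n.
  (* One factor for each of the three nested loops around [step]. *)
  have -> : n ^ 3 = n * (n * (n * 1)) by rewrite !expnS expn0.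
  have P0 : P 0 (denote row_table (graph_input e)).
    by exists finset.set0; [exact: GreedyStart | exact: step_inv_input].
  apply: (@denote_for_count n _ _ _ P) P0 => //; first by rewrite denote_n.
  move=> t1 s1 sn1 Pt1; apply: (@denote_for_count n _ _ _ P) Pt1 => //.
  move=> t2 s2 sn2 Pt2; apply: (@denote_for_count n _ _ _ P) Pt2 => //.
  by move=> t3 s3 _; apply: P1.
exists D => //; apply/setP=> x; rewrite inE hD.
by case: (x \in D).
Qed.

End Greedy_correctness.

(** * The approximation ratio *)

Local Open Scope ring_scope.
Local Open Scope classical_set_scope.

(** From 1 - 1/K <= exp(-1/K) one gets 1 <= exp(-i/K) N, and logarithms give the bound. *)
Lemma geometric_decay_steps (R : realType) (K N i : nat) :
  (0 < K)%N -> (0 < N)%N -> (K ^ i <= K.-1 ^ i * N)%N ->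
  i%:R <= K%:R * ln N%:R :> R.
Proof.
move=> K0 N0; rewrite -(ler_nat R) natrM !natrX => h.
have K0r : 0 < K%:R :> R by rewrite ltr0n.
have N0r : 0 < N%:R :> R by rewrite ltr0n.
have kE : K.-1%:R = K%:R - 1 :> R by rewrite -subn1 natrB.
have hexp : K.-1%:R <= K%:R * expR (- K%:R^-1) :> R.
  have := expR_ge1Dx (- K%:R^-1 : R).
  rewrite -(ler_pM2l K0r) mulrDr mulr1 mulrN mulfV ?gt_eqF // => h1.
  by rewrite kE.
have : K%:R ^+ i <= K%:R ^+ i * (expR (- K%:R^-1) ^+ i * N%:R) :> R.
  apply: (le_trans h); rewrite mulrA -exprMn ler_pM2r //.
  by rewrite lerXn2r // nnegrE ?ler0n // mulr_ge0 // ?expR_ge0.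
rewrite -[X in X <= _]mulr1 ler_pM2l ?exprn_gt0 // -expRM_natl => h1.
have : ln 1 <= ln (expR (i%:R * - K%:R^-1) * N%:R) :> R.
  by rewrite ler_ln // posrE // mulr_gt0 // expR_gt0.
rewrite ln1 lnM ?posrE ?expR_gt0 // expRK mulrN addrC subr_ge0.
by rewrite ler_pdivrMr // mulrC.
Qed.

Lemma greedy_ratio (R : realType) (n k d i : nat) :
  (0 < n)%N -> (0 < k)%N -> (d <= n)%N -> (d <= 2 * i + 3)%N ->
  (i%:R <= k%:R ^+ 2 * ln (n ^ 3)%:R :> R) ->
  d%:R <= (6 * Num.sqrt (n%:R * ln n%:R) + 3) * k%:R :> R.
Proof.
move=> n0 k0 dn di hi.
have n1 : 1 <= n%:R :> R by rewrite ler1n.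
have n0r : 0 < n%:R :> R by rewrite ltr0n.
have k1 : 1 <= k%:R :> R by rewrite ler1n.
have L0 : 0 <= ln n%:R :> R by rewrite ln_ge0.
set S := Num.sqrt _; have S0 : 0 <= S by exact: sqrtr_ge0.
have S2 : S * S = n%:R * ln n%:R by rewrite -expr2 sqr_sqrtr // mulr_ge0 // ltW.
have dnr : d%:R <= n%:R :> R by rewrite ler_nat.
have dir : d%:R <= 2 * i%:R + 3 :> R.
  by move: di; rewrite -(ler_nat R) natrD natrM.
rewrite natrX lnXn // -[_ *+ 3]mulr_natl in hi.
set L := ln n%:R in L0 S2 hi.
(* If n <= k S, the bound d <= n suffices. Otherwise n k L = k S S <= n S gives k L <= S, so that i
   <= 3 k S and d <= 6 k S + 3. *)
case: (lerP (n%:R : R) (k%:R * S)) => [nkS|kSn]; first by nra.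
have kL : k%:R * L <= S.
  rewrite -(ler_pM2l n0r); have := S2; nra.
have : k%:R ^+ 2 * (3 * L) <= 3 * k%:R * S by rewrite expr2; nra.
by nra.
Qed.

(** For n >= 3 the square root is at least 1 and absorbs the additive 3, whence the constant 9 = 6 +
    3. *)
Lemma ratio_bigO (R : realType) :
  (fun n : nat => 6 * Num.sqrt (n%:R * ln n%:R) + 3 : R^o) =O_\oo
  (fun n : nat => Num.sqrt (n%:R * ln n%:R) : R^o).
Proof.
apply/eqOP; near=> k; near=> n.
have n3 : (3 <= n)%N by near: n; exists 3%N.
have n3r : 3 <= n%:R :> R by rewrite (ler_nat R 3).
have n0r : 0 < n%:R :> R by lra.
have S1 : 1 <= Num.sqrt (n%:R * ln n%:R) :> R.
  rewrite -[X in X <= _]sqrtr1 ler_wsqrtr //.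
  (* This yields ln n >= 1 - 1/n, hence n ln n >= n - 1 >= 1. *)
  have : ln (n%:R^-1) <= n%:R^-1 - 1 :> R.
    rewrite -ler_expR lnK ?posrE ?invr_gt0 //.
    by have := expR_ge1Dx (n%:R^-1 - 1 : R); lra.
  rewrite lnV ?posrE // lerNl opprB => h.
  have : n%:R * (1 - n%:R^-1) <= n%:R * ln n%:R :> R by rewrite ler_pM2l.
  by rewrite mulrBr mulfV ?gt_eqF // mulr1; lra.
rewrite ger0_norm; last by lra.
rewrite ger0_norm; last by lra.
have k9 : 9 <= k by near: k; exact: nbhs_pinfty_ge.
by nra.
Unshelve. all: by end_near. Qed.

Theorem theorem6 (R : realType) :
  exists (alg : cmd) (r : nat -> R^o),
    [/\ polynomial_time alg,
        approximation_algorithm r alg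
      & r =O_\oo (fun n : nat => Num.sqrt (n%:R * ln n%:R) : R^o)].
Proof.
exists (compile greedy), (fun n => 6 * Num.sqrt (n%:R * ln n%:R) + 3).
have [c [k run]] := @compile_poly greedy isT.
split; last exact: ratio_bigO.
(* The factor 2^k comes from n + 1 <= 2 n, valid because a connected graph has a vertex. *)
- exists (c * 2 ^ k)%N, k => n e _ [n0 _]; rewrite card_ord in n0.
  have [t et ht] := run (graph_input e).
  exists t, (set_output n (denote greedy (graph_input e))); split.
    exact: (ex_intro2 _ _ _ et (erefl _)).
  apply: (leq_trans ht); rewrite -mulnA -expnMn.
  apply: leq_trans (leq_addr _ _); rewrite leq_mul2l; apply/orP; right.
  case: (k) => [|k']; first by rewrite !expn0.
  by rewrite leq_exp2r //=; lia.
move=> n e ge [n0 _]; have n_gt0 := n0; rewrite card_ord in n_gt0.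
have [t et _] := run (graph_input e).
pose o : 'I_n := Ordinal n_gt0.
have [D rD outD] := @denote_greedy n e o erefl.
have [Dopt feas cDopt] := opt_feasible e.
exists t, D; split.
- exact: (ex_intro2 _ _ _ et (esym outD)).
- by apply: (greedy_feasible (o := o) ge); rewrite card_ord.
have [i [Di hi]] := greedy_size ge rD feas; rewrite cDopt card_ord in hi.
have k_gt0 := @opt_gt0 _ e n0.
(* The decay bound is used with K the square of the optimum and N = n^3. *)
apply: (@greedy_ratio _ _ _ _ i) => //.
  by rewrite -[X in (_ <= X)%N](card_ord n) max_card.
rewrite -natrX; apply: geometric_decay_steps => //; rewrite expn_gt0.
  by rewrite k_gt0.
by rewrite n_gt0.
Qed.
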